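(* Let $R$ be a ring with unity, let $M$ be an $R$-module and $M\to E(M)$ its injective envelope. Then $M$ is trace in $E(M)$ via this map if and only if $M$ is quasi-injective.
   Context: $R$ is not necessarily commutative; modules are left modules. For $R$-modules $M,X$, the trace module of $M$ in $X$ is $\tau_M(X)=\sum_{\alpha\in\operatorname{Hom}_R(M,X)}\alpha(M)\subseteq X$. A submodule $M\subseteq X$ is a trace submodule of $X$ if $M=\tau_N(X)$ for some $R$-module $N$. For an injective $R$-homomorphism $\iota:M\to X$, $M$ is trace in $X$ via $\iota$ if $\operatorname{Im}(\iota)$ is a trace submodule of $X$. An $R$-module $M$ is quasi-injective if for any submodule $L\subseteq M$, every homomorphism $L\to M$ extends to an endomorphism of $M$. *)

(* Defs.v *)
From HB Require Import structures.
From mathcomp Require Import all_boot all_order all_algebra.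
From mathcomp Require Import boolp classical_sets.

Set Implicit Arguments.
Unset Strict Implicit.
Unset Printing Implicit Defensive.

Import GRing.Theory.

Local Open Scope classical_set_scope.
Local Open Scope ring_scope.

(* Modules are left modules [lmodType R] over a [pzRingType], that is, a unital
   associative ring, not necessarily commutative and possibly trivial.
   A submodule of [X] is given by a boolean predicate [P] on [X] together with
   [L : subLmodType P]; with classical logic ([boolp]) every linearly closed
   [set X] arises in this way. *)

(* The sum of the submodules [alpha(M)] consists of the finite sums of values
   [alpha m]; the same [alpha] may be repeated in the list. *)
Definition trace_module (R : pzRingType) (M X : lmodType R) : set X :=
  [set x | exists s : seq ({linear M -> X} * M), x = \sum_(p <- s) p.1 p.2].
Arguments trace_module {R} M X.

Definition is_trace_submodule (R : pzRingType) (X : lmodType R) (S : set X) :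
    Prop :=
  exists N : lmodType R, S = trace_module N X.

(* Only meaningful for an injective [iota]. *)
Definition is_trace_via (R : pzRingType) (M X : lmodType R)
    (iota : {linear M -> X}) : Prop :=
  is_trace_submodule (range iota).

Definition quasi_injective (R : pzRingType) (M : lmodType R) : Prop :=
  forall (P : pred M) (L : subLmodType P) (f : {linear L -> M}),
    exists g : {linear M -> M}, forall x : L, g (val x) = f x.

Definition injective_module (R : pzRingType) (E : lmodType R) : Prop :=
  forall (A B : lmodType R) (i : {linear A -> B}) (f : {linear A -> E}),
    injective i -> exists g : {linear B -> E}, forall a : A, g (i a) = f a.

Definition essential_mono (R : pzRingType) (M E : lmodType R)
    (iota : {linear M -> E}) : Prop :=
  injective iota /\
  forall (P : pred E) (L : subLmodType P),
    range (val : L -> E) `&` range iota = [set 0] ->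
    range (val : L -> E) = [set 0].

Definition injective_envelope (R : pzRingType) (M E : lmodType R)
    (iota : {linear M -> E}) : Prop :=
  injective_module E /\ essential_mono iota.

(* Main.v *)
(** If the image of [iota] is a trace, it is stable under the endomorphisms of
    [E]; a partial endomorphism of [M] extends to an endomorphism of [E] because
    [E] is injective, and this extension then restricts to [M].  Conversely, when
    [M] is quasi-injective, [iota M] is the trace of [M] itself: given
    [alpha : M -> E], the restriction of [alpha] to [alpha^-1 (iota M)] extends to
    some [g : M -> M]; the image of [iota \o g - alpha] meets [iota M] trivially,
    so it vanishes by essentiality and [alpha] takes values in [iota M]. *)
Require Import Defs.
From HB Require Import structures.
From mathcomp Require Import all_boot all_order all_algebra.
From mathcomp Require Import boolp classical_sets.

Import GRing.Theory.
Local Open Scope ring_scope.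

(** Lets quasi-injectivity and essentiality, both stated for [subLmodType], be applied to preimages
    and ranges. *)
Lemma set_subLmodType {R : pzRingType} {X : lmodType R} {S : set X} :
    S 0 -> (forall (a : R) x y, S x -> S y -> S (a *: x + y)) ->
  exists (P : pred X) (L : subLmodType P), range (val : L -> X) = S.
Proof.
move=> S0 SP; pose P : pred X := fun x => `[< S x >].
have closedP : subsemimod_closed P.
  split; first split.
  - exact/asboolP.
  - move=> x y /asboolP Sx /asboolP Sy; apply/asboolP.
    by rewrite -[x]scale1r; apply: SP.
  - move=> a x /asboolP Sx; apply/asboolP.
    by rewrite -[a *: x]addr0; apply: SP.
pose W := {x : X | P x}.
pose m := GRing.SubChoice_isSubLmodule.Build R X P W closedP.
pose L : subLmodType P := HB.pack W m.
exists P, L; apply/seteqP; split=> [_ [x _ <-]|x Sx]; first exact/asboolP/(valP x).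
by exists (Sub x (asboolT Sx) : L) => //; rewrite SubK.
Qed.

(** Preimages under [iota] are picked by choice; injectivity of [iota] makes them unique, and this
    forces linearity. *)
Lemma linear_factor {R : pzRingType} {A M E : lmodType R}
    {iota : {linear M -> E}} (h : {linear A -> E}) :
  injective iota -> (forall a, range iota (h a)) ->
  exists g : {linear A -> M}, forall a, iota (g a) = h a.
Proof.
move=> iota_inj im_h.
have /choice[g gP] : forall a, exists m, iota m = h a.
  by move=> a; have [m _ <-] := im_h a; exists m.
have g_lin : linear g.
  by move=> c a b; apply: iota_inj; rewrite linearP !gP linearP.
pose m := GRing.isLinear.Build _ _ _ _ g g_lin.
by exists (HB.pack_for {linear A -> M} g m).
Qed.

Lemma trace_module_stable {R : pzRingType} {N E : lmodType R}
    (h : {linear E -> E}) (x : E) :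
  trace_module N E x -> trace_module N E (h x).
Proof.
move=> [s ->].
exists [seq (h \o p.1 : {linear N -> E}, p.2) | p : {linear N -> E} * N <- s].
by rewrite linear_sum big_map.
Qed.

Lemma trace_quasi_injective {R : pzRingType} {M E : lmodType R}
    {iota : {linear M -> E}} :
  injective_module E -> injective iota -> is_trace_via iota -> quasi_injective M.
Proof.
move=> E_inj iota_inj [N imN] P L f.
(* Injectivity of [E] is used twice: to extend from [L] to [M], then along [iota] to an endomorphism
   of [E], to which stability of the trace applies. *)
have [h hP] := E_inj _ _ (val : {linear L -> M}) (iota \o f) val_inj.
have [h' h'P] := E_inj _ _ iota h iota_inj.
have h_im m : range iota (h m).
  rewrite -h'P imN; apply: trace_module_stable.
  by rewrite -imN; exists m.
have [g gP] := linear_factor h iota_inj h_im.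
by exists g => x; apply: iota_inj; rewrite gP hP.
Qed.

Lemma quasi_injective_im {R : pzRingType} {M E : lmodType R}
    {iota : {linear M -> E}} (alpha : {linear M -> E}) :
  essential_mono iota -> quasi_injective M -> forall m, range iota (alpha m).
Proof.
move=> [iota_inj iota_ess] M_qi.
have [| |P [L L_im]] := @set_subLmodType R M (alpha @^-1` range iota).
- by exists 0 => //; rewrite !linear0.
- move=> a x y [u _ ux] [v _ vy]; exists (a *: u + v) => //.
  by rewrite !linearP ux vy.
have alphaL (x : L) : range iota (alpha (val x)).
  suff: range (val : L -> M) (val x) by rewrite L_im.
  by exists x.
have [f fP] := linear_factor (alpha \o (val : {linear L -> M})) iota_inj alphaL.
have [g gP] := M_qi P L f.
pose d : {linear M -> E} := (iota \o g) \- alpha.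
have [| |Q [K K_im]] := @set_subLmodType R E (range d).
- by exists 0 => //; rewrite linear0.
- by move=> a _ _ [x _ <-] [y _ <-]; exists (a *: x + y) => //; rewrite linearP.
have d0 : range d = [set 0]%classic.
  rewrite -K_im; apply: iota_ess; rewrite K_im; apply/seteqP.
  split=> [_ [[m _ <-] [m' _ dm]]|_ ->].
    (* If [d m = iota m'], then [alpha m = iota (g m - m')], so [m] lies in [L], where [iota \o g]
       agrees with [alpha]; hence [d m = 0]. *)
    have [x _ xm] : range (val : L -> M) m.
      rewrite L_im; exists (g m - m') => //.
      by rewrite linearB dm /d /= subKr.
    by rewrite /d /= -xm gP fP /= subrr.
  by split; exists 0 => //; rewrite linear0.
move=> m; exists (g m) => //.
have : range d (d m) by exists m.
by rewrite d0 => /eqP; rewrite /d /= subr_eq0 => /eqP.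
Qed.

Theorem corollary3p6 (R : pzRingType) (M E : lmodType R)
    (iota : {linear M -> E}) (hE : injective_envelope iota) :
  is_trace_via iota <-> quasi_injective M.
Proof.
have [E_inj iota_ess] := hE; split.
  exact: trace_quasi_injective E_inj iota_ess.1.
move=> M_qi; exists M; apply/seteqP; split=> [_ [m _ <-]|_ [s ->]].
  by exists [:: (iota, m)]; rewrite big_seq1.
(* The range is closed under finite sums, so it is enough to treat a single value [alpha m]. *)
apply: (big_ind (range iota)).
- by exists 0 => //; rewrite linear0.
- by move=> _ _ [x _ <-] [y _ <-]; exists (x + y) => //; rewrite linearD.
- by move=> p _; apply: quasi_injective_im.
Qed.
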